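(* Let $k\ge 0$ be an integer and let $\lambda, y$ be real numbers with $|\lambda y|<1$ and $|\lambda k y|<1$. For $n\ge0$ put $$T_n(y)=e_{\lambda}(y)-1-\frac{(1)_{1,\lambda}}{1!}y-\frac{(1)_{2,\lambda}}{2!}y^{2}-\cdots-\frac{(1)_{n,\lambda}}{n!}y^{n}.$$ For an integer $j$ define $Q_j(y)=\frac{e_{\lambda}(jy)-e_{\lambda}(y)}{j-1}$ if $j\neq 1$, and $Q_1(y)=\frac{y}{1+\lambda y}e_\lambda(y)=\sum_{n=1}^\infty n\frac{(1)_{n,\lambda}}{n!}y^n$ (the limit of $\frac{e_\lambda(xy)-e_\lambda(y)}{x-1}$ as $x\to1$). Then $$\sum_{n=0}^{\infty}S_{2}(n,k)\,T_n(y)=\frac{1}{k!}\sum_{j=0}^{k}\binom{k}{j}(-1)^{k-j}Q_j(y).$$ In particular, if $|\lambda|<1$ and $|\lambda k|<1$, $$\sum_{n=0}^{\infty}S_{2}(n,k)\bigg(e_{\lambda}(1)-1-\frac{(1)_{1,\lambda}}{1!}-\cdots-\frac{(1)_{n,\lambda}}{n!}\bigg)=\frac{1}{k!}\sum_{j=0}^{k}\binom{k}{j}(-1)^{k-j}Q_j(1).$$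
   Context: For real $\lambda$ the generalized falling factorials are $(x)_{0,\lambda}=1$ and $(x)_{n,\lambda}=x(x-\lambda)\cdots(x-(n-1)\lambda)$ for $n\ge1$. The degenerate exponential is $e_{\lambda}(t)=\sum_{n=0}^{\infty}\frac{(1)_{n,\lambda}}{n!}t^{n}$ (equal to $(1+\lambda t)^{1/\lambda}$ for $\lambda\ne0$, $|\lambda t|<1$, and to $e^t$ for $\lambda=0$). $S_2(n,k)$ are the (ordinary) Stirling numbers of the second kind, defined by $x^n=\sum_{k=0}^n S_2(n,k)(x)_k$ with $(x)_k=x(x-1)\cdots(x-k+1)$, $(x)_0=1$ (so $S_2(n,k)=0$ for $k>n$). *)

(* Defs.v *)
From Stdlib Require Import Reals Lra Lia ZArith.
From Coquelicot Require Import Coquelicot.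
Open Scope R_scope.

(* (x)_{n,lambda} = x (x - lambda) ... (x - (n-1) lambda). *)
Fixpoint gfalling (lambda x : R) (n : nat) : R :=
  match n with
  | O => 1
  | S m => gfalling lambda x m * (x - INR m * lambda)
  end.

Definition falling (x : R) (n : nat) : R := gfalling 1 x n.

Definition degexp_coef (lambda : R) (n : nat) : R :=
  gfalling lambda 1 n / INR (fact n).

(* Coquelicot's [PSeries a t] is the sum of the a_n t^n where that series
   converges, in particular for |lambda t| < 1. *)
Definition degexp (lambda t : R) : R := PSeries (degexp_coef lambda) t.

(* [sum_f_R0 f n] is f 0 + ... + f n. *)
Definition degexp_tail (lambda : R) (n : nat) (y : R) : R :=
  degexp lambda y - sum_f_R0 (fun m => degexp_coef lambda m * y ^ m) n.

Definition Qdiff (lambda : R) (j : Z) (y : R) : R :=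
  if Z.eq_dec j 1 then y / (1 + lambda * y) * degexp lambda y
  else (degexp lambda (IZR j * y) - degexp lambda y) / (IZR j - 1).

(* The falling factorials are a basis of the polynomials, so the first
   condition determines S2 n k for k <= n. *)
Definition is_stirling2 (S2 : nat -> nat -> R) : Prop :=
  (forall (n : nat) (x : R),
      x ^ n = sum_f_R0 (fun k => S2 n k * falling x k) n) /\
  (forall n k : nat, (n < k)%nat -> S2 n k = 0).

Fixpoint stirling2_rec (n k : nat) : R :=
  match n, k with
  | O, O => 1
  | O, S _ => 0
  | S _, O => 0
  | S m, S l => INR (S l) * stirling2_rec m (S l) + stirling2_rec m l
  end.

Lemma stirling2_rec_small (n k : nat) : (n < k)%nat -> stirling2_rec n k = 0.
Proof.
revert k; induction n as [|n IH]; intros [|k] H; simpl stirling2_rec;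
  try reflexivity; try lia.
rewrite !IH by lia; ring.
Qed.

Lemma stirling2_rec_step (n N : nat) (x : R) :
  x * sum_f_R0 (fun k => stirling2_rec n k * falling x k) N =
  sum_f_R0 (fun k => stirling2_rec (S n) k * falling x k) (S N)
  - INR (S N) * stirling2_rec n (S N) * falling x (S N).
Proof.
induction N as [|N IH].
- simpl; unfold falling; simpl; ring.
- rewrite tech5, Rmult_plus_distr_l, IH, (tech5 _ (S N)).
  change (stirling2_rec (S n) (S (S N))) with
    (INR (S (S N)) * stirling2_rec n (S (S N)) + stirling2_rec n (S N)).
  change (falling x (S (S N))) with (falling x (S N) * (x - INR (S N) * 1)).
  ring.
Qed.

Lemma is_stirling2_rec : is_stirling2 stirling2_rec.
Proof.
split; [intros n x | exact stirling2_rec_small].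
induction n as [|n IH].
- simpl; unfold falling; simpl; ring.
- rewrite <- tech_pow_Rmult, IH, stirling2_rec_step, stirling2_rec_small by lia.
  ring.
Qed.

(* Main.v *)
(** Abel summation turns [sum_n x^n T_n] into the divided difference of the
    power series at [x y] and [y] (its derivative when [x = 1]): the boundary
    terms [x^(N+1) T_N], respectively [(N+1) T_N], are dominated by tails of an
    absolutely convergent series.  The theorem is the linear combination of
    these sums at [x = 0, ..., k] given by the explicit formula
    [k! S2(n,k) = sum_j C(k,j) (-1)^(k-j) j^n]. *)

Require Import Defs.
From Stdlib Require Import Reals ZArith Lra Lia.
From Coquelicot Require Import Coquelicot.
Open Scope R_scope.

(** * Stirling numbers of the second kind *)

Lemma falling_nat_small (m i : nat) : (m < i)%nat -> falling (INR m) i = 0.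
Proof.
unfold falling; induction i as [|i IH]; intros H; [lia|]; simpl gfalling.
destruct (Nat.eq_dec m i) as [->|Hne]; [ring|].
rewrite IH by lia; ring.
Qed.

Lemma falling_nat_neq_0 (m i : nat) : (i <= m)%nat -> falling (INR m) i <> 0.
Proof.
unfold falling; induction i as [|i IH]; intros H; simpl gfalling; [lra|].
apply Rmult_integral_contrapositive_currified; [apply IH; lia|].
assert (INR i < INR m) by (apply lt_INR; lia); lra.
Qed.

(** Evaluation at the natural nodes gives a triangular linear system whose diagonal entries
    [falling (INR m) m] are nonzero. *)
Lemma falling_expansion_unique (c d : nat -> R) (n : nat) :
  (forall x, sum_f_R0 (fun k => c k * falling x k) n =
             sum_f_R0 (fun k => d k * falling x k) n) ->
  forall k, (k <= n)%nat -> c k = d k.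
Proof.
revert c d; induction n as [|n IH]; intros c d H k Hk.
- replace k with 0%nat by lia.
  generalize (H 0); unfold falling; simpl; lra.
- (* At the nodes [INR m] with [m <= n] the last term vanishes, so the lower
     coefficients are found one after the other. *)
  assert (low : forall m, (m <= n)%nat -> c m = d m).
  { intros m; induction m as [m IHm] using (well_founded_induction lt_wf).
    intros Hm.
    assert (E : sum_f_R0 (fun i => (c i - d i) * falling (INR m) i) (S n) = 0).
    { rewrite (sum_eq _ (fun i => c i * falling (INR m) i
                                  - d i * falling (INR m) i)) by (intros; ring).
      rewrite minus_sum, H; ring. }
    (* Terms below [m] cancel by [IHm], and terms above [m] vanish because the node [INR m] is a
       root of [falling _ i] for [i > m]. *)
    assert (P : forall N, (m <= N)%nat ->
      sum_f_R0 (fun i => (c i - d i) * falling (INR m) i) N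
      = (c m - d m) * falling (INR m) m).
    { induction N as [|N IHN]; intros HN.
      - replace m with 0%nat by lia; reflexivity.
      - rewrite tech5; destruct (Nat.eq_dec m (S N)) as [->|Hne].
        + rewrite sum_eq_R0; [ring|]; intros i Hi.
          rewrite IHm by lia; ring.
        + rewrite IHN by lia; rewrite (falling_nat_small m (S N)) by lia; ring. }
    rewrite P in E by lia.
    apply Rmult_integral in E; destruct E as [E|E]; [now apply Rminus_diag_uniq|].
    exfalso; revert E; apply falling_nat_neq_0; lia. }
  destruct (Nat.eq_dec k (S n)) as [->|Hne]; [|apply low; lia].
  generalize (H (INR (S n))); rewrite !tech5.
  rewrite (sum_eq _ (fun k => d k * falling (INR (S n)) k) n)
    by (intros; rewrite low by lia; reflexivity).
  intros E; apply Rplus_eq_reg_l in E.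
  apply Rmult_eq_reg_r in E; [exact E|].
  apply falling_nat_neq_0; lia.
Qed.

Lemma is_stirling2_unique (S2 S2' : nat -> nat -> R) :
  is_stirling2 S2 -> is_stirling2 S2' -> forall n k, S2 n k = S2' n k.
Proof.
intros [H Z] [H' Z'] n k.
destruct (Nat.lt_ge_cases n k) as [Hk|Hk].
- rewrite Z, Z' by lia; reflexivity.
- apply (falling_expansion_unique (S2 n) (S2' n) n); [|exact Hk].
  intros x; rewrite <- H, <- H'; reflexivity.
Qed.

Lemma C_absorb (k j : nat) : (j <= k)%nat ->
  (INR (S k) - INR j) * Binomial.C (S k) j = INR (S k) * Binomial.C k j.
Proof.
intros Hj; unfold Binomial.C.
replace (S k - j)%nat with (S (k - j)) by lia.
rewrite !fact_simpl, !mult_INR, <- minus_INR by lia.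
replace (S k - j)%nat with (S (k - j)) by lia.
field; repeat split; try apply INR_fact_neq_0; apply not_0_INR; lia.
Qed.

(** Both sides satisfy a(n+1, k+1) = (k+1) (a(n, k+1) + a(n, k)). On the left this comes from
    writing one factor j as (k+1) - (k+1-j): [C_absorb] turns (k+1-j) C(k+1, j) into (k+1) C(k, j),
    and the lowered exponent of -1 flips the sign. *)
Lemma stirling2_rec_explicit (n k : nat) :
  sum_f_R0 (fun j => Binomial.C k j * (-1) ^ (k - j) * INR j ^ n) k
  = INR (fact k) * stirling2_rec n k.
Proof.
revert k; induction n as [|n IH]; intros k.
(* Since [INR j ^ 0] is 1 even at j = 0, the sum is the binomial expansion of (1 - 1)^k. *)
- rewrite (sum_eq _ (fun j => Binomial.C k j * 1 ^ j * (-1) ^ (k - j)))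
    by (intros; rewrite pow1; simpl; ring).
  rewrite <- binomial; replace (1 + -1) with 0 by ring.
  destruct k as [|k]; simpl stirling2_rec; [simpl; ring|].
  rewrite pow_ne_zero by lia; ring.
- destruct k as [|k].
  + simpl; unfold Binomial.C; simpl; field.
  + change (stirling2_rec (S n) (S k)) with
      (INR (S k) * stirling2_rec n (S k) + stirling2_rec n k).
    rewrite Rmult_plus_distr_l.
    replace (INR (fact (S k)) * (INR (S k) * stirling2_rec n (S k)))
      with (INR (S k) * (INR (fact (S k)) * stirling2_rec n (S k))) by ring.
    replace (INR (fact (S k)) * stirling2_rec n k)
      with (INR (S k) * (INR (fact k) * stirling2_rec n k))
      by (rewrite fact_simpl, mult_INR; ring).
    rewrite <- !IH, !tech5, Rmult_plus_distr_l, !scal_sum.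
    rewrite (sum_eq _ (fun j =>
        Binomial.C (S k) j * (-1) ^ (S k - j) * INR j ^ n * INR (S k)
        + Binomial.C k j * (-1) ^ (k - j) * INR j ^ n * INR (S k)) k).
    * rewrite sum_plus, <- tech_pow_Rmult; ring.
    * intros j Hj.
      generalize (C_absorb k j Hj); intros A.
      replace (Binomial.C k j * (-1) ^ (k - j) * INR j ^ n * INR (S k))
        with (INR (S k) * Binomial.C k j * ((-1) ^ (k - j) * INR j ^ n)) by ring.
      rewrite <- A.
      replace (S k - j)%nat with (S (k - j)) by lia; simpl pow; ring.
Qed.

Lemma stirling2_explicit (S2 : nat -> nat -> R) : is_stirling2 S2 ->
  forall n k, S2 n k = / INR (fact k) *
    sum_f_R0 (fun j => Binomial.C k j * (-1) ^ (k - j) * INR j ^ n) k.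
Proof.
intros H n k.
rewrite (is_stirling2_unique _ _ H is_stirling2_rec), stirling2_rec_explicit.
field; apply INR_fact_neq_0.
Qed.

(** * Series of weighted tails *)

Lemma is_series_sum_f_R0 (f : nat -> nat -> R) (l : nat -> R) (k : nat) :
  (forall j, (j <= k)%nat -> is_series (f j) (l j)) ->
  is_series (fun n => sum_f_R0 (fun j => f j n) k) (sum_f_R0 l k).
Proof.
induction k as [|k IH]; intros H; simpl; [apply H; lia|].
apply (is_series_plus (fun n => sum_f_R0 (fun j => f j n) k) (f (S k))).
- apply IH; intros; apply H; lia.
- apply H; lia.
Qed.

Lemma is_series_sum_f_R0_lim (u : nat -> R) (l : R) :
  is_series u l <-> is_lim_seq (sum_f_R0 u) l.
Proof.
split; intros H.
- apply (is_lim_seq_ext (sum_n u)); [apply sum_n_Reals|exact H].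
- apply (is_lim_seq_ext (sum_f_R0 u) (sum_n u) l); [|exact H].
  intros; symmetry; apply sum_n_Reals.
Qed.

(** As [w] is nondecreasing, w(n+1) can be moved inside the tail: the absolute value is at most the
    sum of w(m) |u(m)| over m > n, a tail of a convergent series. *)
Lemma is_lim_seq_weighted_tail (u w : nat -> R) (l : R) :
  (forall n, 0 <= w n) -> (forall m n, (m <= n)%nat -> w m <= w n) ->
  ex_series (fun n => Rabs (u n)) ->
  ex_series (fun n => w n * Rabs (u n)) ->
  is_series u l ->
  is_lim_seq (fun n => w (S n) * (l - sum_f_R0 u n)) 0.
Proof.
intros w0 wmon Hu Hwu Hl.
apply is_lim_seq_abs_0.
set (v := fun n => w n * Rabs (u n)) in *.
apply is_lim_seq_le_le with (u := fun _ => 0)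
  (w := fun n => Series v - sum_f_R0 v n).
- intros n; split; [apply Rabs_pos|].
  rewrite <- (is_series_unique _ _ Hl).
  rewrite (Series_incr_n u (S n)) by (try lia; now exists l).
  rewrite (Series_incr_n v (S n)) by (try lia; assumption).
  simpl pred.
  replace (sum_f_R0 u n + Series (fun k => u (S n + k)%nat) - sum_f_R0 u n)
    with (Series (fun k => u (S n + k)%nat)) by ring.
  replace (sum_f_R0 v n + Series (fun k => v (S n + k)%nat) - sum_f_R0 v n)
    with (Series (fun k => v (S n + k)%nat)) by ring.
  rewrite Rabs_mult, (Rabs_pos_eq (w (S n))) by apply w0.
  assert (Hu' : ex_series (fun k => Rabs (u (S n + k)%nat)))
    by exact (proj1 (ex_series_incr_n (fun k => Rabs (u k)) (S n)) Hu).
  eapply Rle_trans.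
  + apply Rmult_le_compat_l; [apply w0|apply Series_Rabs, Hu'].
  + rewrite <- Series_scal_l; apply Series_le.
    * intros k; split.
      -- apply Rmult_le_pos; [apply w0|apply Rabs_pos].
      -- apply Rmult_le_compat_r; [apply Rabs_pos|apply wmon; lia].
    * exact (proj1 (ex_series_incr_n v (S n)) Hwu).
- apply is_lim_seq_const.
- replace (Finite 0) with (Finite (Series v - Series v)) by (f_equal; ring).
  apply is_lim_seq_minus'; [apply is_lim_seq_const|].
  apply is_series_sum_f_R0_lim, Series_correct, Hwu.
Qed.

(** Summation by parts: (x - 1) x^n = x^(n+1) - x^n, and passing from one tail to the next subtracts
    a single term of [u]. *)
Lemma sum_geometric_tails (u : nat -> R) (l x : R) (N : nat) :
  (x - 1) * sum_f_R0 (fun n => x ^ n * (l - sum_f_R0 u n)) N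
  = x ^ S N * (l - sum_f_R0 u N) + sum_f_R0 (fun n => u n * x ^ n) N - l.
Proof.
induction N as [|N IH]; [simpl; ring|].
rewrite tech5, Rmult_plus_distr_l, IH, !tech5; simpl pow; ring.
Qed.

(** The counterpart at x = 1: a term u(m) with m <= N belongs to exactly m of the tails, those of
    index below m. *)
Lemma sum_tails (u : nat -> R) (l : R) (N : nat) :
  sum_f_R0 (fun n => l - sum_f_R0 u n) N
  = INR (S N) * (l - sum_f_R0 u N) + sum_f_R0 (fun n => INR n * u n) N.
Proof.
induction N as [|N IH]; [simpl; ring|].
rewrite tech5, IH, !tech5, (S_INR (S N)); ring.
Qed.

Lemma is_series_geometric_tails (u : nat -> R) (l x lx : R) :
  x <> 1 ->
  is_lim_seq (fun n => x ^ S n * (l - sum_f_R0 u n)) 0 ->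
  is_series (fun n => u n * x ^ n) lx ->
  is_series (fun n => x ^ n * (l - sum_f_R0 u n)) ((lx - l) / (x - 1)).
Proof.
intros Hx H0 Hlx.
apply is_series_sum_f_R0_lim in Hlx; apply is_series_sum_f_R0_lim.
apply is_lim_seq_ext with (u := fun N =>
  / (x - 1) * (x ^ S N * (l - sum_f_R0 u N) + sum_f_R0 (fun n => u n * x ^ n) N
               - l)).
- intros N; rewrite <- sum_geometric_tails; field; lra.
- replace (Finite ((lx - l) / (x - 1)))
    with (Rbar_mult (/ (x - 1)) (0 + lx - l))
    by (simpl; f_equal; field; lra).
  apply is_lim_seq_scal_l, is_lim_seq_minus'; [|apply is_lim_seq_const].
  now apply is_lim_seq_plus'.
Qed.

Lemma is_series_tails (u : nat -> R) (l l1 : R) :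
  is_lim_seq (fun n => INR (S n) * (l - sum_f_R0 u n)) 0 ->
  is_series (fun n => INR n * u n) l1 ->
  is_series (fun n => l - sum_f_R0 u n) l1.
Proof.
intros H0 Hl1.
apply is_series_sum_f_R0_lim in Hl1; apply is_series_sum_f_R0_lim.
apply is_lim_seq_ext with (u := fun N =>
  INR (S N) * (l - sum_f_R0 u N) + sum_f_R0 (fun n => INR n * u n) N).
- intros N; symmetry; apply sum_tails.
- replace (Finite l1) with (Finite (0 + l1)) by (f_equal; ring).
  now apply is_lim_seq_plus'.
Qed.

(** * The degenerate exponential *)

(** This is the differential equation (1 + lambda t) f' = f read off on coefficients. *)
Lemma degexp_coef_S (lambda : R) (n : nat) :
  INR (S n) * degexp_coef lambda (S n)
  = (1 - INR n * lambda) * degexp_coef lambda n.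
Proof.
unfold degexp_coef; rewrite fact_simpl, mult_INR; simpl gfalling.
field; split; [apply INR_fact_neq_0|apply not_0_INR; lia].
Qed.

(** The ratio of consecutive absolute values is at most (1 + n |lambda|) r / (n + 1), which tends to
    |lambda| r < 1, so the terms eventually stop increasing. *)
Lemma degexp_coef_bounded (lambda r : R) :
  0 <= r -> Rabs lambda * r < 1 ->
  exists M, forall n, Rabs (degexp_coef lambda n * r ^ n) <= M.
Proof.
intros r0 Hr.
set (t := fun n => Rabs (degexp_coef lambda n * r ^ n)).
(* From n >= r / (1 - |lambda| r) on, (1 + n |lambda|) r <= n, so the ratio is below 1. *)
destruct (INR_unbounded (r / (1 - Rabs lambda * r))) as [N HN].
assert (step : forall n, (N <= n)%nat -> t (S n) <= t n).
{ intros n Hn; unfold t.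
  assert (Sn0 : 0 < INR (S n)) by (apply lt_0_INR; lia).
  apply Rmult_le_reg_l with (INR (S n)); [exact Sn0|].
  rewrite <- (Rabs_pos_eq (INR (S n))) at 1 by lra.
  rewrite <- Rabs_mult; simpl pow.
  replace (INR (S n) * (degexp_coef lambda (S n) * (r * r ^ n)))
    with (INR (S n) * degexp_coef lambda (S n) * (r * r ^ n)) by ring.
  rewrite degexp_coef_S.
  replace ((1 - INR n * lambda) * degexp_coef lambda n * (r * r ^ n))
    with ((1 - INR n * lambda) * r * (degexp_coef lambda n * r ^ n)) by ring.
  rewrite Rabs_mult; apply Rmult_le_compat_r; [apply Rabs_pos|].
  rewrite Rabs_mult, (Rabs_pos_eq r) by lra.
  assert (A : Rabs (1 - INR n * lambda) <= 1 + INR n * Rabs lambda).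
  { eapply Rle_trans; [apply Rabs_triang|].
    rewrite Rabs_Ropp, Rabs_mult, Rabs_R1, (Rabs_pos_eq (INR n)) by apply pos_INR.
    lra. }
  assert (B : r <= INR n * (1 - Rabs lambda * r)).
  { apply Rle_trans with (INR N * (1 - Rabs lambda * r)).
    - apply Rmult_le_reg_r with (/ (1 - Rabs lambda * r));
        [apply Rinv_0_lt_compat; lra|].
      rewrite Rmult_assoc, Rinv_r, Rmult_1_r by lra; apply Rlt_le, HN.
    - apply Rmult_le_compat_r; [lra|now apply le_INR]. }
  rewrite S_INR; nra. }
assert (head : forall P, exists M, forall n, (n <= P)%nat -> t n <= M).
{ induction P as [|P [M HM]].
  - exists (t 0%nat); intros n Hn; replace n with 0%nat by lia; lra.
  - exists (Rmax M (t (S P))); intros n Hn.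
    destruct (Nat.eq_dec n (S P)) as [->|Hne]; [apply Rmax_r|].
    eapply Rle_trans; [apply HM; lia|apply Rmax_l]. }
destruct (head N) as [M HM]; exists M; intros n; fold (t n).
destruct (Nat.le_gt_cases n N) as [Hn|Hn]; [now apply HM|].
apply Rle_trans with (t N); [|apply HM; lia].
induction Hn as [|n Hn IH]; [apply step; lia|].
eapply Rle_trans; [apply step; lia|exact IH].
Qed.

Lemma degexp_CV_radius (lambda y : R) :
  Rabs (lambda * y) < 1 -> Rbar_lt (Rabs y) (CV_radius (degexp_coef lambda)).
Proof.
rewrite Rabs_mult; intros H.
generalize (Rabs_pos y) (Rabs_pos lambda); intros y0 l0.
(* A margin with |lambda| (|y| + d) < 1, valid for lambda = 0 too: boundedness at the larger radius
   |y| + d makes the inequality strict. *)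
set (d := (1 - Rabs lambda * Rabs y) / (1 + Rabs lambda)).
assert (d0 : 0 < d) by (apply Rdiv_lt_0_compat; lra).
assert (Hd : d * (1 + Rabs lambda) = 1 - Rabs lambda * Rabs y)
  by (unfold d; field; lra).
apply Rbar_lt_le_trans with (Rabs y + d); [simpl; lra|].
apply (proj1 (CV_radius_bounded (degexp_coef lambda))).
apply degexp_coef_bounded; [lra|nra].
Qed.

(** * Series at a fixed point of the disk of convergence *)

Section InsideDisk.

Variables lambda y : R.
Hypothesis Hy : Rabs (lambda * y) < 1.

Lemma is_series_degexp :
  is_series (fun n => degexp_coef lambda n * y ^ n) (degexp lambda y).
Proof.
now apply is_pseries_R, PSeries_correct, CV_radius_inside, degexp_CV_radius.
Qed.

Lemma is_series_degexp_deriv :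
  is_series (fun n => INR (S n) * degexp_coef lambda (S n) * y ^ n)
    (PSeries (PS_derive (degexp_coef lambda)) y).
Proof.
apply (is_pseries_R (PS_derive (degexp_coef lambda))).
apply PSeries_correct, CV_radius_inside.
now rewrite CV_radius_derive; apply degexp_CV_radius.
Qed.

Lemma is_series_degexp_euler :
  is_series (fun n => INR n * (degexp_coef lambda n * y ^ n))
    (y * PSeries (PS_derive (degexp_coef lambda)) y).
Proof.
apply is_series_decr_1.
(* The term split off at index 0 is zero because of its factor [INR 0]. *)
replace (plus _ _) with (scal y (PSeries (PS_derive (degexp_coef lambda)) y)).
2: { set (p := PSeries _ _).
     change (y * p = y * p + - (INR 0 * (degexp_coef lambda 0 * y ^ 0))).
     simpl INR; ring. }
apply is_series_ext with (2 := is_series_scal_l y _ _ is_series_degexp_deriv).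
intros n; change (y * (INR (S n) * degexp_coef lambda (S n) * y ^ n) =
  INR (S n) * (degexp_coef lambda (S n) * (y * y ^ n))); ring.
Qed.

(** Termwise, (n+1) a(n+1) + lambda n a(n) = a(n). This links the closed form in [Qdiff] at j = 1
    with y times the derivative series. *)
Lemma degexp_ode :
  (1 + lambda * y) * PSeries (PS_derive (degexp_coef lambda)) y
  = degexp lambda y.
Proof.
rewrite <- (is_series_unique _ _ is_series_degexp); symmetry.
apply is_series_unique.
replace ((1 + lambda * y) * PSeries (PS_derive (degexp_coef lambda)) y)
  with (PSeries (PS_derive (degexp_coef lambda)) y
        + lambda * (y * PSeries (PS_derive (degexp_coef lambda)) y)) by ring.
eapply is_series_ext.
2: exact (is_series_plus _ _ _ _ is_series_degexp_deriv
            (is_series_scal_l lambda _ _ is_series_degexp_euler)).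
intros n; change (INR (S n) * degexp_coef lambda (S n) * y ^ n
  + lambda * (INR n * (degexp_coef lambda n * y ^ n))
  = degexp_coef lambda n * y ^ n).
rewrite degexp_coef_S; ring.
Qed.

Lemma Qdiff_1 :
  Qdiff lambda 1 y = y * PSeries (PS_derive (degexp_coef lambda)) y.
Proof.
unfold Qdiff; destruct (Z.eq_dec 1 1) as [_|n]; [|now destruct n].
rewrite <- degexp_ode; field.
apply Rabs_lt_between in Hy; lra.
Qed.

Lemma is_lim_Qdiff_1 :
  is_lim (fun x => (degexp lambda (x * y) - degexp lambda y) / (x - 1))
    1 (Qdiff lambda 1 y).
Proof.
rewrite Qdiff_1.
assert (D : is_derive (fun x => degexp lambda (x * y)) 1
              (y * PSeries (PS_derive (degexp_coef lambda)) y)).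
{ apply (is_derive_comp (degexp lambda) (fun x => x * y)).
  - rewrite Rmult_1_l; now apply is_derive_PSeries, degexp_CV_radius.
  - auto_derive; [exact I|apply Rmult_1_l]. }
apply is_derive_Reals in D.
apply is_lim_spec; intros eps.
destruct (D eps (cond_pos eps)) as [delta Hd].
exists delta; intros x Hx x1.
(* The derivative at 1 is stated with an increment h, here x - 1. *)
specialize (Hd (x - 1)).
rewrite Rplus_minus in Hd; rewrite Rmult_1_l in Hd.
apply Hd; [now apply Rminus_eq_contra|exact Hx].
Qed.

Lemma ex_series_Rabs_degexp :
  ex_series (fun n => Rabs (degexp_coef lambda n * y ^ n)).
Proof. now apply CV_disk_inside, degexp_CV_radius. Qed.

Lemma ex_series_Rabs_degexp_euler :
  ex_series (fun n => INR n * Rabs (degexp_coef lambda n * y ^ n)).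
Proof.
apply ex_series_incr_1.
assert (H : ex_series (fun n => Rabs (PS_derive (degexp_coef lambda) n * y ^ n)))
  by (apply CV_disk_inside; rewrite CV_radius_derive; now apply degexp_CV_radius).
apply (ex_series_scal_l (Rabs y)) in H.
apply ex_series_ext with (2 := H); intros n.
change (Rabs y * Rabs (INR (S n) * degexp_coef lambda (S n) * y ^ n)
  = INR (S n) * Rabs (degexp_coef lambda (S n) * (y * y ^ n))).
rewrite <- (Rabs_pos_eq (INR (S n))) at 2 by apply pos_INR.
rewrite <- !Rabs_mult; f_equal; ring.
Qed.

(** The boundary terms are controlled with the weight n when j = 1 and with the weight j^n when j >=
    2. *)
Lemma is_series_pow_degexp_tail (j : nat) :
  Rabs (lambda * (INR j * y)) < 1 ->
  is_series (fun n => INR j ^ n * degexp_tail lambda n y)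
    (Qdiff lambda (Z.of_nat j) y).
Proof.
intros Hj; unfold degexp_tail.
destruct (Nat.eq_dec j 1) as [->|j1].
- simpl Z.of_nat; rewrite Qdiff_1.
  apply is_series_ext with (a := fun n => degexp lambda y
    - sum_f_R0 (fun m => degexp_coef lambda m * y ^ m) n);
    [intros n; simpl INR; rewrite pow1; symmetry; apply Rmult_1_l|].
  apply is_series_tails; [|exact is_series_degexp_euler].
  apply (is_lim_seq_weighted_tail _ INR).
  + exact pos_INR.
  + intros; now apply le_INR.
  + exact ex_series_Rabs_degexp.
  + exact ex_series_Rabs_degexp_euler.
  + exact is_series_degexp.
- unfold Qdiff; destruct (Z.eq_dec (Z.of_nat j) 1) as [E|_]; [lia|].
  rewrite <- INR_IZR_INZ.
  assert (x1 : INR j <> 1) by (now apply not_1_INR).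
  apply is_series_geometric_tails; [exact x1| |].
  (* The weight 0^n is not monotone, since 0^0 = 1, but for j = 0 the boundary term 0^(n+1) T_n is
     identically zero. *)
  + destruct (Nat.eq_dec j 0) as [->|j0].
    * apply is_lim_seq_ext with (u := fun _ => 0); [|apply is_lim_seq_const].
      intros n; simpl INR; simpl pow; ring.
    * assert (1 <= INR j) by (apply (le_INR 1); lia).
      apply (is_lim_seq_weighted_tail _ (pow (INR j))).
      -- intros; apply pow_le; lra.
      -- intros; now apply Rle_pow.
      -- exact ex_series_Rabs_degexp.
      (* The weighted terms are the absolute values of the terms of the power series at j y, which
         [Hj] places inside the disk. *)
      -- eapply ex_series_ext;
           [|exact (CV_disk_inside _ _ (degexp_CV_radius _ _ Hj))].
         intros n; simpl.
         rewrite <- (Rabs_pos_eq (INR j ^ n)) by (apply pow_le; lra).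
         rewrite <- Rabs_mult, Rpow_mult_distr; f_equal; ring.
      -- exact is_series_degexp.
  + apply is_series_ext with (a := fun n =>
      degexp_coef lambda n * (INR j * y) ^ n).
    * intros n; rewrite Rpow_mult_distr, (Rmult_comm (INR j ^ n)).
      symmetry; apply Rmult_assoc.
    * now apply is_pseries_R, PSeries_correct, CV_radius_inside,
        degexp_CV_radius.
Qed.

End InsideDisk.

(** * Combination of the weighted series over j = 0, ..., k *)

Lemma is_series_stirling2_degexp_tail (S2 : nat -> nat -> R) (k : nat)
    (lambda y : R) :
  is_stirling2 S2 ->
  Rabs (lambda * y) < 1 -> Rabs (lambda * INR k * y) < 1 ->
  is_series (fun n => S2 n k * degexp_tail lambda n y)
    (/ INR (fact k) *
     sum_f_R0 (fun j => Binomial.C k j * (-1) ^ (k - j)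
                        * Qdiff lambda (Z.of_nat j) y) k).
Proof.
intros hS2 Hy Hk.
(* |lambda j y| is nondecreasing in j, so the bound at k covers every node. *)
assert (Hj : forall j, (j <= k)%nat -> Rabs (lambda * (INR j * y)) < 1).
{ intros j Hj; eapply Rle_lt_trans; [|exact Hk].
  replace (lambda * (INR j * y)) with (INR j * (lambda * y)) by ring.
  replace (lambda * INR k * y) with (INR k * (lambda * y)) by ring.
  rewrite !(Rabs_mult (INR _)), !(Rabs_pos_eq (INR _)) by apply pos_INR.
  apply Rmult_le_compat_r; [apply Rabs_pos|now apply le_INR]. }
apply is_series_ext with (a := fun n => / INR (fact k) *
  sum_f_R0 (fun j => Binomial.C k j * (-1) ^ (k - j)
                     * (INR j ^ n * degexp_tail lambda n y)) k).
- intros n; rewrite (stirling2_explicit S2 hS2), Rmult_assoc; f_equal.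
  rewrite Rmult_comm, scal_sum; apply sum_eq; intros; ring.
- apply (is_series_scal_l (/ INR (fact k)) (fun n => sum_f_R0 (fun j =>
    Binomial.C k j * (-1) ^ (k - j) * (INR j ^ n * degexp_tail lambda n y)) k)).
  apply (is_series_sum_f_R0 (fun j n => Binomial.C k j * (-1) ^ (k - j)
           * (INR j ^ n * degexp_tail lambda n y))).
  intros j Hjk.
  apply (is_series_scal_l (Binomial.C k j * (-1) ^ (k - j))
           (fun n => INR j ^ n * degexp_tail lambda n y)).
  now apply is_series_pow_degexp_tail; [|apply Hj].
Qed.

(** The first two conjuncts check that the closed form chosen for Q_1 agrees with its series, which
    starts at n = 1 and is therefore indexed by [S n], and with the limit of the difference
    quotients. *)
Theorem theorem2p5 (S2 : nat -> nat -> R) (hS2 : is_stirling2 S2)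
    (k : nat) (lambda : R) :
  (forall y : R,
     Rabs (lambda * y) < 1 -> Rabs (lambda * INR k * y) < 1 ->
     is_series (fun n => INR (S n) * degexp_coef lambda (S n) * y ^ S n)
       (Qdiff lambda 1 y) /\
     is_lim (fun x => (degexp lambda (x * y) - degexp lambda y) / (x - 1))
       1 (Qdiff lambda 1 y) /\
     is_series (fun n => S2 n k * degexp_tail lambda n y)
       (/ INR (fact k) *
        sum_f_R0 (fun j => Binomial.C k j * (-1) ^ (k - j)
                           * Qdiff lambda (Z.of_nat j) y) k)) /\
  (Rabs lambda < 1 -> Rabs (lambda * INR k) < 1 ->
     is_series (fun n => S2 n k *
                  (degexp lambda 1 - sum_f_R0 (degexp_coef lambda) n))
       (/ INR (fact k) *
        sum_f_R0 (fun j => Binomial.C k j * (-1) ^ (k - j)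
                           * Qdiff lambda (Z.of_nat j) 1) k)).
Proof.
split.
- intros y Hy Hk; repeat split.
  + rewrite Qdiff_1 by exact Hy.
    apply is_series_ext with (a := fun n =>
      INR (S n) * (degexp_coef lambda (S n) * y ^ S n));
      [intros n; symmetry; apply Rmult_assoc|].
    apply (is_series_incr_1
             (fun n => INR n * (degexp_coef lambda n * y ^ n))).
    replace (plus _ _) with (y * PSeries (PS_derive (degexp_coef lambda)) y)
      by (unfold plus; simpl; ring).
    now apply is_series_degexp_euler.
  + now apply is_lim_Qdiff_1.
  + now apply is_series_stirling2_degexp_tail.
- intros H1 Hk.
  eapply is_series_ext;
    [|apply (is_series_stirling2_degexp_tail S2 k lambda 1 hS2);
      rewrite Rmult_1_r; assumption].
  intros n; unfold degexp_tail; simpl; do 2 f_equal.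
  apply sum_eq; intros; rewrite pow1; ring.
Qed.
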